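(* Let $p\geq 2$ and let $G$ be a connected $K_{1,p+1}$-free $2p$-regular graph. If $G$ is $(p+2)$-star colourable, then $G$ is a locally linear graph and a clique graph, and $K(K(G))\cong G$.
   Context: Graphs are finite and simple. $K_{1,p+1}$-free means no induced subgraph isomorphic to $K_{1,p+1}$. A $k$-star colouring is a proper colouring with $k$ colours such that the subgraph induced by any two colour classes has every component a star. A graph is locally linear if every edge lies in exactly one triangle. The clique graph $K(G)$ is the intersection graph of the maximal cliques of $G$; a graph is a clique graph if it is isomorphic to $K(H)$ for some graph $H$. *)

(* Defs.v *)
From mathcomp Require Import all_boot.
Set Implicit Arguments.
Unset Strict Implicit.
Unset Printing Implicit Defensive.

Record sgraph := SGraph {
  vertex :> finType;
  adj : rel vertex;
  adj_sym : symmetric adj;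
  adj_irrefl : irreflexive adj }.

Definition isomorphic (G H : sgraph) : Prop :=
  exists f : G -> H, bijective f /\ forall x y : G, adj (f x) (f y) = adj x y.

Section Induced.
Variables (G : sgraph) (S : {set G}).
Definition induced_vertex := {x : G | x \in S}.
Definition induced_adj : rel induced_vertex := fun x y => adj (val x) (val y).
Lemma induced_adj_sym : symmetric induced_adj.
Proof. by move=> x y; exact: adj_sym. Qed.
Lemma induced_adj_irrefl : irreflexive induced_adj.
Proof. by move=> x; exact: adj_irrefl. Qed.
Definition induced : sgraph := SGraph induced_adj_sym induced_adj_irrefl.
End Induced.

(* K_{1,q}: the centre is [None], the q leaves are [Some i]. *)
Section Star.
Variable q : nat.
Definition star_adj : rel (option 'I_q) :=
  fun x y => (x == None) != (y == None).
Lemma star_adj_sym : symmetric star_adj.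
Proof. by move=> x y; rewrite /star_adj eq_sym. Qed.
Lemma star_adj_irrefl : irreflexive star_adj.
Proof. by move=> x; rewrite /star_adj eqxx. Qed.
Definition star : sgraph := SGraph star_adj_sym star_adj_irrefl.
End Star.

(* The trivial star K_{1,0} = K_1 is allowed, so isolated vertices are stars. *)
Definition is_star (G : sgraph) : Prop := exists q : nat, isomorphic G (star q).

Definition star_free (q : nat) (G : sgraph) : Prop :=
  forall S : {set G}, ~ isomorphic (induced S) (star q).

Definition regular (d : nat) (G : sgraph) : Prop :=
  forall x : G, #|[set y | adj x y]| = d.

(* Connected graphs have at least one vertex. *)
Definition connected (G : sgraph) : Prop :=
  0 < #|G| /\ forall x y : G, connect (@adj G) x y.

Definition component (G : sgraph) (x : G) : {set G} :=
  [set y | connect (@adj G) x y].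

Definition proper_colouring (k : nat) (G : sgraph) (f : G -> 'I_k) : Prop :=
  forall x y : G, adj x y -> f x != f y.

Definition bicoloured (k : nat) (G : sgraph) (f : G -> 'I_k) (i j : 'I_k) :
    sgraph :=
  induced [set x : G | (f x == i) || (f x == j)].

Definition star_colouring (k : nat) (G : sgraph) (f : G -> 'I_k) : Prop :=
  proper_colouring f /\
  forall i j : 'I_k, i != j ->
  forall x : bicoloured f i j, is_star (induced (component x)).

(* Colourings need not be surjective: at most k colours are used. *)
Definition star_colourable (k : nat) (G : sgraph) : Prop :=
  exists f : G -> 'I_k, star_colouring f.

Definition clique (G : sgraph) (S : {set G}) : bool :=
  [forall x in S, forall y in S, (x != y) ==> adj x y].

Definition triangle (G : sgraph) (S : {set G}) : bool :=
  clique S && (#|S| == 3).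

Definition locally_linear (G : sgraph) : Prop :=
  forall x y : G, adj x y ->
  #|[set S : {set G} | triangle S & [set x; y] \subset S]| = 1.

(* The clique graph of the empty graph is K_1, as set0 is then a maximal
   clique; for nonempty graphs maximal cliques are nonempty. *)
Section CliqueGraph.
Variable G : sgraph.
Definition max_clique := {S : {set G} | maxset (@clique G) S}.
Definition clique_graph_adj : rel max_clique :=
  fun A B => (A != B) && (val A :&: val B != set0).
Lemma clique_graph_adj_sym : symmetric clique_graph_adj.
Proof. by move=> A B; rewrite /clique_graph_adj eq_sym setIC. Qed.
Lemma clique_graph_adj_irrefl : irreflexive clique_graph_adj.
Proof. by move=> A; rewrite /clique_graph_adj eqxx. Qed.
Definition clique_graph : sgraph :=
  SGraph clique_graph_adj_sym clique_graph_adj_irrefl.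
End CliqueGraph.

Definition is_clique_graph (G : sgraph) : Prop :=
  exists H : sgraph, isomorphic G (clique_graph H).

(* Main.v *)
(** Call [w] an out-neighbour of [v] if it is the only neighbour of [v] of its
    colour.  In a star colouring every edge is an arc in at least one direction,
    and with [p + 2] colours a vertex of degree [2p > p + 1] has at most [p]
    out-neighbours.  Double counting the [p |V|] edges forces equality: every
    edge is an arc in exactly one direction, and every vertex has [p]
    out-neighbours of distinct colours and [p] in-neighbours, all of the one
    remaining colour.  Hence no triangle is transitive, and the third vertex of
    a triangle on the arc [(v, w)] is an out-neighbour of [w] of the common
    colour of the in-neighbours of [v], so it is unique.  It exists because the
    in-neighbours of [v] are independent, so that otherwise they would form an
    induced [K_{1,p+1}] with [v] and [w].

    Once every edge lies in exactly one triangle, the maximal cliques are the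
    triangles, and they have the Helly property; so the maximal cliques of
    [K(G)] are the sets of triangles through a given vertex. *)
Require Import Defs.
From mathcomp Require Import all_boot.
Set Implicit Arguments.
Unset Strict Implicit.
Unset Printing Implicit Defensive.

(** * Cliques and induced stars *)

Lemma isomorphic_sym (G H : sgraph) : isomorphic G H -> isomorphic H G.
Proof.
case=> f [[g fK gK] fadj]; exists g; split; first by exists f.
by move=> x y; rewrite -fadj !gK.
Qed.

Lemma adj_neq (G : sgraph) (x y : G) : adj x y -> x != y.
Proof. by apply: contraTneq => ->; rewrite adj_irrefl. Qed.

Lemma cliqueP (G : sgraph) (S : {set G}) :
  reflect {in S &, forall x y, x != y -> adj x y} (clique S).
Proof.
apply: (iffP forall_inP) => [h x y xS yS | h x xS].
  by move/forall_inP: (h x xS) => /(_ y yS)/implyP.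
by apply/forall_inP => y yS; apply/implyP; apply: h.
Qed.

(** If [A] were independent, [v |: A] would induce a star with centre [v], its leaves numbered by
    their rank in [A]; the element [a] is the default that [enum_rank_in] requires. *)
Lemma star_free_adj (G : sgraph) (v : G) (A : {set G}) :
  star_free #|A| G -> A != set0 -> {in A, forall x, adj v x} ->
  exists x y, [/\ x \in A, y \in A & adj x y].
Proof.
move=> sf /set0Pn[a aA] vA.
have [/existsP[x /existsP[y /and3P[]]]|indep] :=
  boolP [exists x, exists y, [&& x \in A, y \in A & adj x y]]; first by exists x, y.
have {}indep x y : x \in A -> y \in A -> adj x y = false.
  move=> xA yA; apply: contraNF indep => xy.
  by apply/existsP; exists x; apply/existsP; exists y; rewrite xA yA.
have vNA : v \notin A by apply/negP => /vA; rewrite adj_irrefl.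
case: (sf (v |: A)).
pose h (x : induced (v |: A)) : star #|A| :=
  if val x == v then None else Some (enum_rank_in aA (val x)).
have inA (x : induced (v |: A)) : val x != v -> val x \in A.
  by move=> xv; have := valP x; rewrite !inE (negPf xv).
exists h; split.
  apply: inj_card_bij => [x y|].
    rewrite /h; have [xv|xv] := eqVneq (val x) v; have [yv|yv] := eqVneq (val y) v => //.
      by move=> _; apply: val_inj; rewrite xv.
    by case=> /(enum_rank_in_inj (inA x xv) (inA y yv))/val_inj.
  by rewrite card_option card_ord card_sig cardsU1 vNA.
move=> x y; rewrite /= /star_adj /induced_adj /h.
have [xv|xv] := eqVneq (val x) v; have [yv|yv] := eqVneq (val y) v.
- by rewrite xv yv adj_irrefl.
- by rewrite xv vA ?inA.
- by rewrite yv adj_sym vA ?inA.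
- by rewrite indep ?inA.
Qed.

(** * Graphs whose edges lie in a unique triangle *)

Section UniqueCommonNeighbour.
Variable G : sgraph.
Hypothesis common_neighbour : forall x y : G, adj x y ->
  exists2 z, adj x z && adj y z & forall t, adj x t -> adj y t -> t = z.

Lemma triangle_clique (x y z : G) :
  adj x y -> adj x z -> adj y z -> clique [set x; y; z].
Proof.
move=> xy xz yz; apply/cliqueP => a b.
rewrite !inE => /orP[/orP[]|] /eqP-> /orP[/orP[]|] /eqP->;
  rewrite ?eqxx // => _; by rewrite // adj_sym.
Qed.

(** A further member of [A] is a common neighbour of [x] and [y], hence [z]; so [A] lies inside the
    triangle, and maximality gives equality. *)
Lemma max_clique_edge (x y z : G) (A : {set G}) :
  adj x y -> adj x z -> adj y z -> maxset (@clique G) A ->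
  x \in A -> y \in A -> A = [set x; y; z].
Proof.
move=> xy xz yz /maxsetP[/cliqueP cA maxA] xA yA.
apply/esym/maxA; first exact: triangle_clique.
apply/subsetP => t tA; rewrite !inE.
have [//|tx] := eqVneq t x; have [//|ty] /= := eqVneq t y.
have [u _ uU] := common_neighbour xy.
have xt : adj x t by apply: cA; rewrite // eq_sym.
have yt : adj y t by apply: cA; rewrite // eq_sym.
by rewrite (uU t xt yt) (uU z xz yz).
Qed.

Lemma max_clique_eq (x y : G) (A B : {set G}) :
  maxset (@clique G) A -> maxset (@clique G) B -> x != y ->
  x \in A -> y \in A -> x \in B -> y \in B -> A = B.
Proof.
move=> mA mB xy xA yA xB yB.
have /cliqueP cA : clique A by case/maxsetP: mA.
have {}xy := cA _ _ xA yA xy; have [z /andP[xz yz] _] := common_neighbour xy.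
by rewrite (max_clique_edge xy xz yz mA) // (max_clique_edge xy xz yz mB).
Qed.

Lemma max_clique_exists (x y : G) :
  adj x y -> exists A : max_clique G, (x \in val A) && (y \in val A).
Proof.
move=> xy; have [z /andP[xz yz] _] := common_neighbour xy.
have [A mA sA] := maxset_exists (triangle_clique xy xz yz).
by exists (Sub A mA); rewrite !(subsetP sA) // !inE eqxx ?orbT.
Qed.

Lemma locally_linear_common_neighbour : locally_linear G.
Proof.
move=> x y xy; have [z /andP[xz yz] zU] := common_neighbour xy.
apply/eqP/cards1P; exists [set x; y; z]; apply/setP => S; rewrite !inE.
have cardxyz : #|[set x; y; z]| = 3.
  rewrite -setUA !cardsU1 cards1 !inE negb_or.
  by rewrite (adj_neq xy) (adj_neq xz) (adj_neq yz).
apply/idP/eqP => [/andP[/andP[/cliqueP cS /eqP S3] sS] | ->]; last first.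
  rewrite /triangle triangle_clique // cardxyz eqxx /=.
  by apply/subsetP => t; rewrite !inE => ->.
have [xS yS] : x \in S /\ y \in S by rewrite !(subsetP sS) // !inE eqxx ?orbT.
apply/eqP; rewrite eqEcard cardxyz S3 leqnn andbT; apply/subsetP => t tS.
rewrite !inE; have [//|tx] := eqVneq t x; have [//|ty] /= := eqVneq t y.
by apply/eqP/zU; apply: cS; rewrite // eq_sym.
Qed.

(** * The iterated clique graph *)

Hypothesis G_gt0 : 0 < #|G|.
Hypothesis degree_gt2 : forall v : G, 2 < #|[set x | adj v x]|.

(** A triangle at [v] uses only two neighbours of [v]; a third neighbour lies in another
    triangle. *)
Lemma two_max_cliques (v : G) :
  exists A B : max_clique G, [/\ A != B, v \in val A & v \in val B].
Proof.
have /card_gt0P[x] : 0 < #|[set x | adj v x]| by rewrite (leq_trans _ (degree_gt2 v)).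
rewrite inE => vx; have [z /andP[vz xz] _] := common_neighbour vx.
have : ~~ ([set y | adj v y] \subset [set x; z]).
  apply: contraL (degree_gt2 v) => /subset_leq_card le2.
  by rewrite -leqNgt (leq_trans le2) // cards2; case: (_ == _).
case/subsetPn => y; rewrite !inE negb_or => vy /andP[yx yz].
have [A /andP[vA xA]] := max_clique_exists vx.
have [B /andP[vB yB]] := max_clique_exists vy.
exists A, B; split=> //; apply: contraTneq yB => <-.
rewrite (max_clique_edge vx vz xz (valP A)) // !inE !negb_or yx yz.
by rewrite eq_sym (adj_neq vy).
Qed.

Lemma max_clique_neq0 (A : max_clique G) : exists v, v \in val A.
Proof.
apply/set0Pn; apply/eqP => A0; have [v _] := card_gt0P G_gt0.
have /maxsetP[_ /(_ [set v])] := valP A; rewrite A0 sub0set => h.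
have /h-/(_ isT)/setP/(_ v) : clique [set v].
  by apply/cliqueP => x y; rewrite !inE => /eqP-> /eqP->; rewrite eqxx.
by rewrite !inE eqxx.
Qed.

Definition cliques_through (v : G) : {set clique_graph G} :=
  [set A : max_clique G | v \in val A].

Lemma cliques_through_clique (v : G) : clique (cliques_through v).
Proof.
apply/cliqueP => A B; rewrite !inE => vA vB AB.
by rewrite /= /clique_graph_adj AB; apply/set0Pn; exists v; rewrite inE vA.
Qed.

(** Distinct vertices share at most one maximal clique, but [v] lies in two. *)
Lemma cliques_through_sub (v w : G) :
  cliques_through v \subset cliques_through w -> v = w.
Proof.
move/subsetP => s; have [A [B [AB vA vB]]] := two_max_cliques v.
have wA : w \in val A by have := s A; rewrite !inE; apply.
have wB : w \in val B by have := s B; rewrite !inE; apply.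
apply/eqP; apply: contraNT AB => vw; apply/eqP/val_inj.
exact: max_clique_eq (valP A) (valP B) vw vA wA vB wB.
Qed.

(** Helly property: if [A], [B], [D] met pairwise without a common vertex, the meeting points would
    span a triangle sharing an edge with both [A] and [B], so [A = B]. *)
Lemma cliques_through_helly (C : {set clique_graph G}) :
  clique C -> exists v, C \subset cliques_through v.
Proof.
move/cliqueP => cC; have [->|/set0Pn[A AC]] := eqVneq C set0.
  by have [v _] := card_gt0P G_gt0; exists v; rewrite sub0set.
have [/subsetP sA|/subsetPn[B BC]] := boolP (C \subset [set A]).
  have [v vA] := max_clique_neq0 A; exists v; apply/subsetP => B /sA.
  by rewrite !inE => /eqP->.
rewrite inE eq_sym => AB.
have meet (X Y : clique_graph G) : X \in C -> Y \in C -> X != Y ->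
    exists2 t, t \in val X & t \in val Y.
  move=> XC YC XY; have /andP[_ /set0Pn[t]] := cC X Y XC YC XY.
  by rewrite inE => /andP[]; exists t.
have eqM (X Y : clique_graph G) (s t : G) : s != t -> s \in val X ->
    t \in val X -> s \in val Y -> t \in val Y -> X = Y.
  move=> st sX tX sY tY; apply: val_inj.
  exact: max_clique_eq (valP X) (valP Y) st sX tX sY tY.
have [v vA vB] := meet A B AC BC AB; exists v; apply/subsetP => D DC.
rewrite inE; apply: contraT => vD.
have DA : A != D by apply: contraNneq vD => <-.
have DB : B != D by apply: contraNneq vD => <-.
have [y yB yD] := meet B D BC DC DB; have [z zA zD] := meet A D AC DC DA.
have vy : v != y by apply: contraNneq vD => ->.
have vz : v != z by apply: contraNneq vD => ->.
have edge (X : clique_graph G) s t : s \in val X -> t \in val X -> s != t -> adj s t.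
  by have /maxsetP[/cliqueP cX _] := valP X; apply: cX.
(* The edge [v z] of [A] has third vertex [y], so [A] is the triangle [v z y]. *)
have yA : y \in val A.
  have [<- //|zy] := eqVneq z y.
  rewrite (max_clique_edge (edge _ _ _ vA zA vz) (edge _ _ _ vB yB vy)
    (edge _ _ _ zD yD zy) (valP A) vA zA).
  by rewrite !inE eqxx orbT.
by case/eqP: AB; apply: eqM vy vA yA vB yB.
Qed.

Lemma cliques_through_max (v : G) :
  maxset (@clique (clique_graph G)) (cliques_through v).
Proof.
apply/maxsetP; split=> [|C cC sC]; first exact: cliques_through_clique.
have [w sw] := cliques_through_helly cC.
have vw := cliques_through_sub (subset_trans sC sw).
by apply/eqP; rewrite eqEsubset sC vw sw.
Qed.

Lemma clique_graph_clique_graph :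
  isomorphic G (clique_graph (clique_graph G)).
Proof.
pose F (v : G) : clique_graph (clique_graph G) := Sub _ (cliques_through_max v).
have F_inj : injective F.
  by move=> v w /(congr1 val) /= vw; apply: cliques_through_sub; rewrite vw.
(* By the Helly property [C] lies in some clique [cliques_through v], and maximality of [C] makes
   them equal. *)
have F_surj C : exists v, F v == C.
  have /maxsetP[cC maxC] := valP C; have [v sv] := cliques_through_helly cC.
  exists v; apply/eqP/val_inj; apply: maxC => //.
  exact: cliques_through_clique.
exists F; split.
  exists (fun C => xchoose (F_surj C)) => [v|C]; last exact/eqP/(xchooseP (F_surj C)).
  exact/F_inj/eqP/(xchooseP (F_surj (F v))).
move=> v w; rewrite /= /clique_graph_adj (inj_eq F_inj).
apply/andP/idP => [[vw /set0Pn[A]] | vw].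
  rewrite !inE => /andP[vA wA]; have /maxsetP[/cliqueP cA _] := valP A.
  exact: cA.
split; first exact: adj_neq.
have [A /andP[vA wA]] := max_clique_exists vw.
by apply/set0Pn; exists A; rewrite !inE vA.
Qed.

End UniqueCommonNeighbour.

(** * The orientation given by a star colouring *)

Section StarColouring.
Variables (p : nat) (G : sgraph) (f : G -> 'I_(p + 2)).
Hypothesis f_star : star_colouring f.

Let f_proper (x y : G) : adj x y -> f x != f y.
Proof. by case: f_star => fp _; apply: fp. Qed.

Definition arc (v w : G) :=
  adj v w && [forall t, adj v t && (f t == f w) ==> (t == w)].

Lemma arc_adj (v w : G) : arc v w -> adj v w.
Proof. by case/andP. Qed.

Lemma arc_uniq (v w t : G) : arc v w -> adj v t -> f t = f w -> t = w.
Proof.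
by case/andP=> _ /forallP/(_ t)/implyP h vt tw; apply/eqP/h; rewrite vt tw /=.
Qed.

Lemma arcPn (v w : G) :
  adj v w -> ~~ arc v w -> exists t, [/\ adj v t, f t = f w & t != w].
Proof.
rewrite /arc => -> /forallPn[t]; rewrite negb_imply => /andP[/andP[vt /eqP tw] ne].
by exists t.
Qed.

(** Otherwise there is a path [w' v w v'] in two colours, which no star contains. *)
Lemma adj_arc (v w : G) : adj v w -> arc v w || arc w v.
Proof.
move=> vw; apply: contraT; rewrite negb_or => /andP[nvw nwv].
have [w' [vw' fw' w'w]] := arcPn vw nvw.
have [|v' [wv' fv' v'v]] := arcPn _ nwv; first by rewrite adj_sym.
case: f_star => _ /(_ _ _ (f_proper vw)).
pose B := bicoloured f (f v) (f w).
pose S := [set x : G | (f x == f v) || (f x == f w)].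
have inS x : (f x == f v) || (f x == f w) -> x \in S by rewrite inE.
have vS : v \in S by rewrite inS // eqxx.
have wS : w \in S by rewrite inS // eqxx orbT.
have v'S : v' \in S by rewrite inS // fv' eqxx.
have w'S : w' \in S by rewrite inS // fw' eqxx orbT.
pose v0 : B := Sub v vS; pose w0 : B := Sub w wS.
pose v1 : B := Sub v' v'S; pose w1 : B := Sub w' w'S.
move=> /(_ v0)[q [h [/bij_inj h_inj h_adj]]].
have v0C : v0 \in component v0 by rewrite inE connect0.
have w0C : w0 \in component v0 by rewrite inE connect1.
have w1C : w1 \in component v0 by rewrite inE connect1.
have v1C : v1 \in component v0.
  by rewrite inE (connect_trans (connect1 (_ : adj v0 w0))) // connect1.
pose C := induced (component v0).
have E1 := h_adj (Sub v0 v0C : C) (Sub w0 w0C : C).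
have E2 := h_adj (Sub v0 v0C : C) (Sub w1 w1C : C).
have E3 := h_adj (Sub w0 w0C : C) (Sub v1 v1C : C).
have E4 : h (Sub v0 v0C : C) != h (Sub v1 v1C : C).
  by rewrite (inj_eq h_inj) -!val_eqE /= eq_sym.
have E5 : h (Sub w0 w0C : C) != h (Sub w1 w1C : C).
  by rewrite (inj_eq h_inj) -!val_eqE /= eq_sym.
(* Each edge of a star has exactly one end at the centre, so [h] sends either both [v0] and [v1] or
   both [w0] and [w1] to [None]. *)
move: E1 E2 E3 E4 E5; rewrite /= /star_adj /induced_adj /= /induced_adj /= vw vw' wv'.
by case: (h _) => [?|]; case: (h _) => [?|]; case: (h _) => [?|]; case: (h _) => [?|].
Qed.

(** * Counting arcs in a regular graph *)

Hypothesis p_ge2 : 2 <= p.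
Hypothesis G_regular : regular (2 * p) G.

Lemma arc_colour_inj (v : G) : {in [set w | arc v w] &, injective f}.
Proof.
by move=> w t; rewrite !inE => vw /arc_adj vt ft; apply/esym/(arc_uniq vw vt).
Qed.

(** With [p.+1] out-neighbours every colour but [f v] would be taken by one, so every neighbour
    would be an out-neighbour and the degree would be [p.+1 < 2 * p]. *)
Lemma out_degree_le (v : G) : #|[set w | arc v w]| <= p.
Proof.
rewrite -(card_in_imset (@arc_colour_inj v)) leqNgt; apply/negP => big.
have cardC : #|[set~ f v]| = p.+1 by rewrite cardsC1 card_ord addn2.
have sub : f @: [set w | arc v w] \subset [set~ f v].
  apply/subsetP => c /imsetP[w]; rewrite inE => /arc_adj/f_proper fvw ->.
  by rewrite !inE eq_sym.
have eqC : f @: [set w | arc v w] = [set~ f v].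
  by apply/eqP; rewrite eqEcard sub cardC.
have : [set w | adj v w] \subset [set w | arc v w].
  apply/subsetP => t; rewrite inE => vt.
  have : f t \in [set~ f v] by rewrite !inE eq_sym f_proper.
  rewrite -eqC => /imsetP[w wo ft]; have vw := wo; rewrite inE in vw.
  by rewrite (arc_uniq vw vt ft).
move/subset_leq_card; rewrite G_regular -(card_in_imset (@arc_colour_inj v)) eqC cardC.
by rewrite mul2n -addnn -addn1 leq_add2l leqNgt p_ge2.
Qed.

Lemma out_degree_and_arcs :
  (forall v : G, #|[set w | arc v w]| = p) /\
  (forall v w : G, adj v w = arc v w + arc w v :> nat).
Proof.
have le2 (v w : G) : adj v w <= arc v w + arc w v ?= iff (adj v w == arc v w + arc w v :> nat).
  split=> //; case: (boolP (adj v w)) => // /adj_arc.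
  by case: (arc v w); case: (arc w v).
have le1 (v : G) : #|[set w | arc v w]| <= p ?= iff (#|[set w | arc v w]| == p).
  by split=> //; apply: out_degree_le.
have outE v : #|[set w | arc v w]| = \sum_w arc v w.
  by rewrite -sum1dep_card big_mkcond.
have sumadj : \sum_(v : G) \sum_(w : G) adj v w = \sum_(v : G) p + \sum_(v : G) p.
  rewrite -big_split /=; apply: eq_bigr => v _; rewrite addnn -mul2n -(G_regular v).
  by rewrite -sum1dep_card [RHS]big_mkcond.
have sumarc : \sum_v \sum_w (arc v w + arc w v) =
    \sum_v #|[set w | arc v w]| + \sum_v #|[set w | arc v w]|.
  under eq_bigr do rewrite big_split /=.
  rewrite big_split /= [X in _ + X]exchange_big /=.
  by under [in RHS]eq_bigr do rewrite outE.
(* The sums satisfy [2p|V| <= 2 * (number of arcs) <= 2p|V|]; [leqif_sum] turns equality of the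
   totals into equality of each term. *)
have [leA eqA] := leqif_sum (fun v (_ : true) => leqif_sum (fun w (_ : true) => le2 v w)).
have [leB eqB] := leqif_sum (fun v (_ : true) => le1 v).
rewrite sumarc sumadj in leA eqA.
have eqS : \sum_v #|[set w | arc v w]| = \sum_(v : G) p.
  by apply/eqP; rewrite eqn_leq leB /= -leq_double -!addnn.
split=> [v|v w].
  by move: eqB; rewrite eqS eqxx => /esym/forallP/(_ v)/eqP.
by move: eqA; rewrite eqS eqxx => /esym/forallP/(_ v)/forallP/(_ w)/eqP.
Qed.

Lemma arc_asym (v w : G) : arc v w -> ~~ arc w v.
Proof.
have := out_degree_and_arcs.2 v w.
by case: (adj v w); case: (arc v w); case: (arc w v).
Qed.

Lemma in_degree (v : G) : #|[set u | arc u v]| = p.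
Proof.
have := G_regular v; have [out _] := out_degree_and_arcs.
have -> : [set w | adj v w] = [set w | arc v w] :|: [set w | arc w v].
  apply/setP => w; rewrite !inE; apply/idP/orP => [/adj_arc/orP //|].
  by case=> /arc_adj //; rewrite adj_sym.
rewrite cardsU out mul2n -addnn; set I := _ :&: _.
have -> : I = set0.
  apply/setP => w; rewrite !inE; apply/negbTE/negP => /andP[/arc_asym/negP].
  exact.
by rewrite cards0 subn0 => /addnI.
Qed.

(** The vertex [v] and its out-neighbours occupy [p.+1] colours. An in-neighbour with one of these
    colours would be an out-neighbour too, so one colour remains. *)
Lemma in_neighbours_colour (v u u' : G) : arc u v -> arc u' v -> f u = f u'.
Proof.
pose O := f v |: f @: [set w | arc v w].
have colour t : arc t v -> f t \in ~: O.
  move=> tv; have vt : adj v t by rewrite adj_sym arc_adj.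
  rewrite !inE negb_or eq_sym f_proper //=; apply/imsetP => -[w].
  rewrite inE => vw ft; have /negP := arc_asym tv; apply.
  by rewrite (arc_uniq vw vt ft).
have cardO : #|~: O| = 1.
  have fv : f v \notin f @: [set w | arc v w].
    by apply/imsetP => -[w]; rewrite inE => /arc_adj/f_proper/eqP.
  rewrite cardsCs setCK card_ord cardsU1 fv (card_in_imset (@arc_colour_inj v)).
  by rewrite out_degree_and_arcs.1 addn2 add1n subSn // subnn.
have /eqP/cards1P[c Oc] := cardO.
by move=> /colour + /colour; rewrite Oc !inE => /eqP-> /eqP->.
Qed.

Lemma no_transitive_triangle (x y z : G) : arc x z -> arc y z -> ~~ adj x y.
Proof.
move=> xz yz; apply/negP => /f_proper.
by rewrite (in_neighbours_colour xz yz) eqxx.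
Qed.

(** Any orientation but the cyclic one gives some vertex two adjacent in-neighbours. *)
Lemma triangle_arcs (v w z : G) :
  arc v w -> adj v z -> adj w z -> arc w z && arc z v.
Proof.
move=> vw vz wz.
have wz' : arc w z.
  have /orP[//|zw] := adj_arc wz.
  by have := no_transitive_triangle vw zw; rewrite vz.
rewrite wz' /=; have /orP[vz'|//] := adj_arc vz.
by have := no_transitive_triangle vz' wz'; rewrite arc_adj.
Qed.

(** * Triangles from star-freeness *)

Hypothesis G_star_free : star_free p.+1 G.

Lemma arc_common_neighbour (v w : G) : arc v w ->
  exists2 z, adj v z && adj w z & forall t, adj v t -> adj w t -> t = z.
Proof.
move=> vw; have wNin : w \notin [set u | arc u v] by rewrite inE arc_asym.
have [x [y [xA yA xy]]] : exists x y, [/\ x \in w |: [set u | arc u v],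
    y \in w |: [set u | arc u v] & adj x y].
  apply: (@star_free_adj _ v).
  - by rewrite cardsU1 wNin in_degree.
  - by apply/set0Pn; exists w; rewrite !inE eqxx.
  - move=> t; rewrite !inE => /orP[/eqP->|/arc_adj]; first exact: arc_adj.
    by rewrite adj_sym.
(* In-neighbours of [v] are pairwise non-adjacent, so the edge found has [w] as an end. *)
have [z zv wz] : exists2 z, arc z v & adj w z.
  move: xA yA xy; rewrite !inE => /orP[/eqP->|xv] /orP[/eqP->|yv].
  - by rewrite adj_irrefl.
  - by exists y.
  - by exists x; rewrite // adj_sym.
  - by rewrite (negPf (no_transitive_triangle xv yv)).
have vz : adj v z by rewrite adj_sym arc_adj.
exists z => [|t vt wt]; first by rewrite vz.
have /andP[wz' _] := triangle_arcs vw vz wz.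
have /andP[_ tv] := triangle_arcs vw vt wt.
(* Both [t] and [z] are in-neighbours of [v], hence of one colour, and [w] has only one neighbour of
   that colour. *)
exact: arc_uniq wz' wt (in_neighbours_colour tv zv).
Qed.

Lemma star_colouring_common_neighbour (x y : G) : adj x y ->
  exists2 z, adj x z && adj y z & forall t, adj x t -> adj y t -> t = z.
Proof.
case/adj_arc/orP => /arc_common_neighbour // [z /andP[yz xz] zU].
by exists z => [|t xt yt]; [rewrite xz | apply: zU].
Qed.

End StarColouring.

Theorem theorem16 (p : nat) (hp : 2 <= p) (G : sgraph)
    (Gconn : connected G) (Gfree : star_free p.+1 G)
    (Greg : regular (2 * p) G) (Gcol : star_colourable (p + 2) G) :
  locally_linear G /\ is_clique_graph G /\
  isomorphic (clique_graph (clique_graph G)) G.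
Proof.
case: Gcol Gconn => f f_star [G_gt0 _].
have common := star_colouring_common_neighbour f_star hp Greg Gfree.
have deg (v : G) : 2 < #|[set x | adj v x]|.
  by rewrite Greg mul2n -addnn (leq_trans (_ : 2 < 2 + 2)) // leq_add.
have KK := clique_graph_clique_graph common G_gt0 deg.
split; first exact: locally_linear_common_neighbour.
by split; [exists (clique_graph G) | apply: isomorphic_sym].
Qed.
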